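(* Let $G$ be an embedded graph with embedded medial graph $G_m$ and medial weight system $W_m=(\boldsymbol\alpha,\boldsymbol\beta,\boldsymbol\gamma)$. Let $\Gamma=\prod_{i=1}^6\xi_i(A_i)$, where the (possibly empty) pairwise disjoint sets $A_1,\dots,A_6$ have union $E(G)$ and $\xi_1,\dots,\xi_6$ are the six elements of $\mathfrak{G}$. Then $$q(G_m;W_m,t)=q\big((G^{\Gamma})_m;W_m^{\Gamma},t\big),$$ or equivalently, $$Q(G;(\boldsymbol\alpha,\boldsymbol\beta,\boldsymbol\gamma),t)=Q\big(G^{\Gamma};(\boldsymbol\alpha,\boldsymbol\beta,\boldsymbol\gamma)^{\Gamma},t\big).$$
   Context: Embedded graphs. An embedded graph is a finite graph (loops and multiple edges allowed) cellularly embedded in a closed, possibly non-orientable, surface. Equivalently, it is a ribbon graph: a surface with boundary that is a union of vertex discs and edge discs, meeting in disjoint line segments, each segment on the boundary of exactly one vertex disc and one edge disc, each edge disc containing exactly two segments. Equivalently, it is an arrow presentation: a set of circles with disjoint labelled arrows on them, each label appearing on exactly two arrows, up to relabelling pairs and reversing both arrows of a given label. Circles correspond to vertex discs; for each label $e$ an edge disc is attached by orienting its boundary, choosing two disjoint boundary arcs directed accordingly, and identifying these with the two $e$-labelled arrows respecting directions. Twisted duality. For an edge $e$ of $G$ (given as an arrow presentation): $G^{\tau(e)}$ is obtained by reversing exactly one of the two $e$-labelled arrows; $G^{\delta(e)}$ is obtained as follows: if $A,B$ are the two $e$-labelled arrows, add a segment with an $e$-labelled arrow directed from the head of $A$ to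 the tail of $B$, and a segment with an $e$-labelled arrow directed from the head of $B$ to the tail of $A$, and delete $A$ and $B$ together with the arcs containing them. On each edge $\tau^2=\delta^2=(\tau\delta)^3=1$; operations on different edges commute; words act by $G^{\xi\zeta(e)}=(G^{\zeta(e)})^{\xi(e)}$; so $\mathfrak{G}=\langle\delta,\tau\mid\delta^2,\tau^2,(\tau\delta)^3\rangle\cong S_3$ acts at each edge. $G^{\Gamma}$ is obtained by applying $\xi_i$ at every edge of $A_i$, for each $i$; edges of $G$ and $G^\Gamma$ are naturally identified. Medial graphs. The medial graph $G_m$ of a cellularly embedded graph $G$ is the 4-regular embedded graph in the same surface with a vertex $v_e$ of degree 4 on each edge $e$ of $G$ and edges drawn by following the face boundaries of $G$. By convention each isolated vertex of $G$ contributes a vertexless closed curve to $G_m$, which counts as one component in each graph state. The canonical checkerboard colouring of $G_m$ colours black the faces containing vertices of $G$ and white the other faces. Transition polynomial. A vertex state at a vertex $v$ of a 4-regular graph $F$ is a pairing of the four half-edges at $v$ (with $v$ replaced by two arcs joining paired half-edges); a graph state $s$ is a choice of vertex state at each vertex, and $c(s)$ is the number of closed curves it produces. For a canonically checkerboard coloured $G_m$ the three vertex states at $v$ are: white split (pairs half-edges sharing a white corner at $v$, so arcs follow the boundaries of white faces), black split (pairs half-edges sharing a black corner), and crossing (pairs opposite half-edges). A medial weight system $W_m=(\boldsymbol\alpha,\boldsymbol\beta,\boldsymbol\gamma)$ assigns to each vertex $v_e$ (equivalently each edge $e$ of $G$) a triple $(\alpha_e,\beta_e,\gamma_e)$ of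 elements of a commutative ring $\mathcal{R}$ with unit, the weights of the white split, black split and crossing, respectively. With $\omega(s)$ the product over all vertices of the weights of the chosen vertex states, $$Q(G;(\boldsymbol\alpha,\boldsymbol\beta,\boldsymbol\gamma),t):=q(G_m;W_m,t):=\sum_s\omega(s)\,t^{c(s)},$$ summing over all graph states $s$ of $G_m$. Permuted weights. $\mathfrak{G}$ acts on triples through $\eta:\tau\mapsto(1\,3),\ \delta\mapsto(1\,2)$, permuting positions, with words applied right to left: $\tau:(\alpha,\beta,\gamma)\mapsto(\gamma,\beta,\alpha)$; $\delta\mapsto(\beta,\alpha,\gamma)$; $\tau\delta\mapsto(\gamma,\alpha,\beta)$; $\delta\tau\mapsto(\beta,\gamma,\alpha)$; $\tau\delta\tau\mapsto(\alpha,\gamma,\beta)$. $W_m^{\Gamma}=(\boldsymbol\alpha,\boldsymbol\beta,\boldsymbol\gamma)^{\Gamma}$ is the weight system whose triple at $e\in A_i$ is the image of $(\alpha_e,\beta_e,\gamma_e)$ under $\xi_i$. *)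

(* Defs.v *)
From HB Require Import structures.
From mathcomp Require Import all_boot all_algebra.

Set Implicit Arguments.
Unset Strict Implicit.
Unset Printing Implicit Defensive.

Import GRing.Theory.
Local Open Scope ring_scope.

(* [(e, i, b)] is an end of the arrow number [i] among the two arrows labelled
   [e]: its head if [b = true], its tail if [b = false]. *)
Definition arrow_end (E : finType) : finType := (E * bool * bool)%type.

Notation tail e i := (e, i, false).
Notation head e i := (e, i, true).

(* The arrows cut the circles that carry them into the arrows themselves and
   complementary arcs.  [arc] sends an arrow end to the other end of the
   complementary arc starting there.  Any fixed-point-free involution arises in
   this way: the non-empty circles are the orbits of [arc] together with the
   exchange of the head and the tail of each arrow.  [empty_circles] is the
   number of circles without arrows, i.e., of isolated vertices. *)
Record embedded_graph (E : finType) := EmbeddedGraph {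
  arc : arrow_end E -> arrow_end E;
  arcK : involutive arc;
  arc_neq : forall x, arc x != x;
  empty_circles : nat
}.

Section Replace.
Variables (E : finType) (G : embedded_graph E).
Variables (f g : arrow_end E -> arrow_end E).
Hypotheses (fK : cancel f g) (gK : cancel g f).

Lemma replace_arcK : involutive (g \o arc G \o f).
Proof. by move=> x /=; rewrite gK arcK fK. Qed.

Lemma replace_arc_neq x : (g \o arc G \o f) x != x.
Proof. by rewrite /= (can2_eq gK fK) arc_neq. Qed.

(* The arrows of [G] are replaced by new ones: the end [x] of a new arrow is at
   the point where [G] has the end [f x]. *)
Definition replace_arrows : embedded_graph E :=
  EmbeddedGraph replace_arcK replace_arc_neq (empty_circles G).
End Replace.

Section PartialDuality.
Variables (E : finType) (e : E).

Definition tau_end (x : arrow_end E) : arrow_end E :=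
  let: (e', i, b) := x in if (e' == e) && i then (e', i, ~~ b) else x.

Lemma tau_endK : involutive tau_end.
Proof.
move=> [[e' i] b] /=.
by case: ifP => /= E1; rewrite E1 ?negbK.
Qed.

(* Reversing the other arrow gives an equivalent arrow presentation. *)
Definition tau_at (G : embedded_graph E) : embedded_graph E :=
  replace_arrows G tau_endK tau_endK.

(* If [A] and [B] are the arrows [i] and [~~ i], the new arrow [i] goes from the
   head of [A] to the tail of [B]. *)
Definition delta_end (x : arrow_end E) : arrow_end E :=
  let: (e', i, b) := x in
  if e' != e then x else if b then tail e' (~~ i) else head e' i.

Definition delta_end_inv (x : arrow_end E) : arrow_end E :=
  let: (e', i, b) := x in
  if e' != e then x else if b then tail e' i else head e' (~~ i).

Lemma delta_endK : cancel delta_end delta_end_inv.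
Proof.
move=> [[e' i] b] /=.
by case E1: (e' != e); case: b; rewrite /= E1 ?negbK.
Qed.

Lemma delta_end_invK : cancel delta_end_inv delta_end.
Proof.
move=> [[e' i] b] /=.
by case E1: (e' != e); case: b; rewrite /= E1 ?negbK.
Qed.

Definition delta_at (G : embedded_graph E) : embedded_graph E :=
  replace_arrows G delta_endK delta_end_invK.
End PartialDuality.

Inductive generator := Tau | Delta.

Definition word := seq generator.

(* Equality in the group <delta, tau | delta^2, tau^2, (tau delta)^3> of the
   elements represented by two words.  Inverse letters are not needed as the
   generators are involutions. *)
Inductive word_eq : word -> word -> Prop :=
| word_eq_refl u : word_eq u u
| word_eq_sym u v : word_eq u v -> word_eq v u
| word_eq_trans u v w : word_eq u v -> word_eq v w -> word_eq u w
| word_eq_tau2 u v : word_eq (u ++ [:: Tau; Tau] ++ v) (u ++ v)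
| word_eq_delta2 u v : word_eq (u ++ [:: Delta; Delta] ++ v) (u ++ v)
| word_eq_taudelta3 u v :
    word_eq (u ++ [:: Tau; Delta; Tau; Delta; Tau; Delta] ++ v) (u ++ v).

Definition enumerates_group (xi : 'I_6 -> word) : Prop :=
  (forall i j, word_eq (xi i) (xi j) -> i = j) /\
  (forall w, exists i, word_eq w (xi i)).

Definition generator_at (E : finType) (a : generator) (e : E) :
    embedded_graph E -> embedded_graph E :=
  match a with Tau => tau_at e | Delta => delta_at e end.

(* The rightmost letter acts first. *)
Definition word_at (E : finType) (w : word) (e : E) (G : embedded_graph E) :
    embedded_graph E :=
  foldr (fun a H => generator_at a e H) G w.

(* The order of the edges is irrelevant, as operations on different edges
   commute. *)
Definition twisted_dual (E : finType) (xi : 'I_6 -> word)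
    (A : 'I_6 -> {set E}) (G : embedded_graph E) : embedded_graph E :=
  foldr (fun i H => foldr (fun e K => word_at (xi i) e K) H (enum (A i)))
    G (enum 'I_6).

(* Each half-edge [h] has a black and a white side at its end-vertex;
   [black_mate h] and [white_mate h] are the other half-edges bounding these two
   corners.  Thus [h], [black_mate h], [white_mate (black_mate h)] and
   [white_mate h] are in this cyclic order around the vertex.  Edges respect the
   colours of the sides, so these data determine the embedding: its flags are
   the pairs of a half-edge and a colour, and its black (white) faces are the
   orbits of [edge_mate] and [black_mate] ([white_mate]).
   [free_loops] is the number of vertexless closed curves. *)
Record checkerboard_graph := CheckerboardGraph {
  vertex : finType;
  half_edge : finType;
  end_vertex : half_edge -> vertex;
  edge_mate : half_edge -> half_edge;
  black_mate : half_edge -> half_edge;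
  white_mate : half_edge -> half_edge;
  free_loops : nat;
  end_vertex_regular : forall v, #|[set h | end_vertex h == v]| = 4%N;
  edge_mateK : involutive edge_mate;
  edge_mate_neq : forall h, edge_mate h != h;
  black_mateK : involutive black_mate;
  black_mate_neq : forall h, black_mate h != h;
  black_mate_end : forall h, end_vertex (black_mate h) = end_vertex h;
  white_mateK : involutive white_mate;
  white_mate_neq : forall h, white_mate h != h;
  white_mate_end : forall h, end_vertex (white_mate h) = end_vertex h;
  black_white_neq : forall h, black_mate h != white_mate h
}.

Inductive vertex_state := WhiteSplit | BlackSplit | Crossing.

Definition ord_of_vertex_state (s : vertex_state) : 'I_3 :=
  match s with
  | WhiteSplit => inord 0 | BlackSplit => inord 1 | Crossing => inord 2
  end.

Definition vertex_state_of_ord (i : 'I_3) : vertex_state :=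
  match val i with 0 => WhiteSplit | 1 => BlackSplit | _ => Crossing end.

Lemma ord_of_vertex_stateK : cancel ord_of_vertex_state vertex_state_of_ord.
Proof. by case; rewrite /vertex_state_of_ord /= inordK. Qed.

HB.instance Definition _ := Finite.copy vertex_state
  (can_type ord_of_vertex_stateK).

Section Transition.
Variable F : checkerboard_graph.

Definition graph_state := {ffun vertex F -> vertex_state}.

Definition vertex_state_mate (s : vertex_state) (h : half_edge F) :
    half_edge F :=
  match s with
  | WhiteSplit => white_mate h
  | BlackSplit => black_mate h
  | Crossing => white_mate (black_mate h)
  end.

Definition state_mate (s : graph_state) (h : half_edge F) : half_edge F :=
  vertex_state_mate (s (end_vertex h)) h.

Definition state_rel (s : graph_state) : rel (half_edge F) :=
  fun h k => (k == edge_mate h) || (k == state_mate s h).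

Definition state_curves (s : graph_state) : nat :=
  (n_comp (state_rel s) predT + free_loops F)%N.

Variable R : comPzRingType.

(* The weights (alpha, beta, gamma) of the white split, the black split and the
   crossing. *)
Definition vertex_weight (w : R * R * R) (s : vertex_state) : R :=
  match s with
  | WhiteSplit => w.1.1 | BlackSplit => w.1.2 | Crossing => w.2
  end.

Definition state_weight (W : vertex F -> R * R * R) (s : graph_state) : R :=
  \prod_(v : vertex F) vertex_weight (W v) (s v).

Definition transition_poly (W : vertex F -> R * R * R) (t : R) : R :=
  \sum_(s : graph_state) state_weight W s * t ^+ state_curves s.
End Transition.

Section Medial.
Variables (E : finType) (G : embedded_graph E).

(* The half-edges of the medial graph at [v_e] run to the four corners of the
   edge disc [e], which are the ends of the two [e]-labelled arrows, and then
   along the boundary of a vertex disc to the next edge disc.  The boundary of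
   the edge disc [e] runs through the tail and head of one arrow and then the
   tail and head of the other one.  The corner of [v_e] between the ends of one
   arrow faces a vertex disc, hence is black; the corner between the head of an
   arrow and the tail of the other one lies in a face of [G], hence is white. *)
Definition medial_black (x : arrow_end E) : arrow_end E :=
  let: (e, i, b) := x in (e, i, ~~ b).

Definition medial_white (x : arrow_end E) : arrow_end E :=
  let: (e, i, b) := x in (e, ~~ i, ~~ b).

Definition medial_end (x : arrow_end E) : E := x.1.1.

Lemma medial_regular e : #|[set x | medial_end x == e]| = 4%N.
Proof.
have -> : [set x | medial_end x == e] = setX (setX [set e] setT) setT.
  by apply/setP => -[[e' i] b]; rewrite !inE /= !andbT.
by rewrite !cardsX cards1 !cardsT card_bool.
Qed.

Lemma medial_blackK : involutive medial_black.
Proof. by move=> [[e i] b]; rewrite /= negbK. Qed.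

Lemma medial_whiteK : involutive medial_white.
Proof. by move=> [[e i] b]; rewrite /= !negbK. Qed.

Lemma medial_black_neq x : medial_black x != x.
Proof. by case: x => [[e i] []]; rewrite xpair_eqE andbF. Qed.

Lemma medial_white_neq x : medial_white x != x.
Proof. by case: x => [[e i] []]; rewrite xpair_eqE andbF. Qed.

Lemma medial_black_end x : medial_end (medial_black x) = medial_end x.
Proof. by case: x => [[]]. Qed.

Lemma medial_white_end x : medial_end (medial_white x) = medial_end x.
Proof. by case: x => [[]]. Qed.

Lemma medial_black_white_neq x : medial_black x != medial_white x.
Proof. by case: x => [[e []] b]; rewrite /= !xpair_eqE /= andbF. Qed.

Definition medial : checkerboard_graph :=
  CheckerboardGraph (empty_circles G) medial_regular (@arcK E G)
    (@arc_neq E G) medial_blackK medial_black_neq medial_black_end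
    medial_whiteK medial_white_neq medial_white_end medial_black_white_neq.

Definition Qpoly (R : comPzRingType) (W : E -> R * R * R) (t : R) : R :=
  transition_poly (F := medial) W t.
End Medial.

Section PermutedWeights.
Variables (E : finType) (R : comPzRingType).

Definition generator_weight (a : generator) (w : R * R * R) : R * R * R :=
  let: (x, y, z) := w in
  match a with Tau => (z, y, x) | Delta => (y, x, z) end.

Definition word_weight (u : word) (w : R * R * R) : R * R * R :=
  foldr generator_weight w u.

Definition permuted_weights (xi : 'I_6 -> word) (A : 'I_6 -> {set E})
    (W : E -> R * R * R) (e : E) : R * R * R :=
  if [pick i | e \in A i] is Some i then word_weight (xi i) (W e) else W e.
End PermutedWeights.

(* Main.v *)
Require Import Defs.
From mathcomp Require Import all_boot all_algebra.

(** Passing from [G] to a partial dual at [e] is a mere change of names: the ends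
    of the new arrows sit at the points where the old ones were, so that the new
    medial graph has the same half-edges joined by the same edges, and only the
    rule that says which pairing of the four half-edges at [v_e] is called white,
    black or crossing is different.  The three pairings of a 4-set are permuted
    among themselves: reversing one arrow keeps the pairs formed by the ends of
    each arrow (black) and exchanges the other two, whereas [delta] makes the
    white pairs the ends of the new arrows and so exchanges white and black.
    These are exactly the permutations of the positions in the weight triple.
    Hence graph states correspond bijectively with the same closed curves and the
    same weights ([transition_poly_transport], applied to one generator at one
    edge in [transition_poly_generator]).

    The general case follows by applying generators one at a time.  It then
    remains to identify the weights accumulated in this way with the permuted
    weights: each edge lies in at most one of the disjoint sets [A i], so its
    triple is changed once, by the word [xi i]. *)

Set Implicit Arguments.
Unset Strict Implicit.
Unset Printing Implicit Defensive.

Import GRing.Theory.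
Local Open Scope ring_scope.

(** * Closed curves of a graph state *)

Section StateCurves.
Variable F : checkerboard_graph.
Implicit Types (s : graph_state F) (h : half_edge F).

Lemma vertex_state_mate_inj a : injective (@vertex_state_mate F a).
Proof.
case: a => h k /=; first exact: (inv_inj (@white_mateK F)).
  exact: (inv_inj (@black_mateK F)).
by move/(inv_inj (@white_mateK F))/(inv_inj (@black_mateK F)).
Qed.

Lemma vertex_state_mate_end a h :
  end_vertex (vertex_state_mate a h) = end_vertex h.
Proof.
by case: a; rewrite /= ?white_mate_end ?black_mate_end.
Qed.

Lemma state_mate_inj s : injective (state_mate s).
Proof.
move=> h k Ehk; have: end_vertex h = end_vertex k.
  rewrite -(vertex_state_mate_end (s (end_vertex h))).
  by rewrite -[LHS]/(end_vertex (state_mate s h)) Ehk vertex_state_mate_end.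
move: Ehk; rewrite /state_mate => + Ev; rewrite Ev.
exact: vertex_state_mate_inj.
Qed.

(** Both kinds of steps, along an edge and through a vertex, permute the finite
    set of half-edges, so iterating a step leads back to its starting point. *)
Lemma state_rel_connect_sym s : connect_sym (state_rel s).
Proof.
have sym := relU_sym (fconnect_sym (inv_inj (@edge_mateK F)))
                     (fconnect_sym (@state_mate_inj s)).
move=> h k; have Erel : state_rel s =2
    relU (frel (@edge_mate F)) (frel (state_mate s)).
  by move=> x y; rewrite /state_rel /= !(eq_sym y).
by rewrite !(eq_connect Erel).
Qed.

End StateCurves.

(** * Transport of the transition polynomial *)

(** The transition polynomial only sees which pairings occur at each vertex and
    with which weights, and not which of them are called white, black and
    crossing: [sigma v] may rename them arbitrarily at each vertex. *)
Section Transport.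
Variables (F F' : checkerboard_graph).
Variables (phi : half_edge F' -> half_edge F) (phi' : half_edge F -> half_edge F').
Variables (psi : vertex F' -> vertex F) (psi' : vertex F -> vertex F').
Variables sigma sigma' : vertex F' -> vertex_state -> vertex_state.
Hypotheses (phiK : cancel phi phi') (phi'K : cancel phi' phi).
Hypotheses (psiK : cancel psi psi') (psi'K : cancel psi' psi).
Hypotheses (sigmaK : forall v, cancel (sigma v) (sigma' v)).
Hypotheses (sigma'K : forall v, cancel (sigma' v) (sigma v)).
Hypothesis phi_end : forall h, end_vertex (phi h) = psi (end_vertex h).
Hypothesis phi_edge : forall h, phi (edge_mate h) = edge_mate (phi h).
Hypothesis phi_state : forall a h,
  phi (vertex_state_mate a h) = vertex_state_mate (sigma (end_vertex h) a) (phi h).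
Hypothesis same_loops : free_loops F = free_loops F'.

Definition transport_state (s : graph_state F') : graph_state F :=
  [ffun v => sigma (psi' v) (s (psi' v))].

Definition transport_state_inv (s : graph_state F) : graph_state F' :=
  [ffun v => sigma' v (s (psi v))].

Lemma transport_stateK : cancel transport_state transport_state_inv.
Proof. by move=> s; apply/ffunP => v; rewrite !ffunE psiK sigmaK. Qed.

Lemma transport_state_invK : cancel transport_state_inv transport_state.
Proof. by move=> s; apply/ffunP => v; rewrite !ffunE sigma'K psi'K. Qed.

Lemma phi_state_rel s h k :
  state_rel (transport_state s) (phi h) (phi k) = state_rel s h k.
Proof.
rewrite /state_rel /state_mate ffunE phi_end psiK -phi_state -phi_edge.
by rewrite !(can_eq phiK).
Qed.

Lemma transport_state_curves s :
  state_curves (transport_state s) = state_curves s.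
Proof.
rewrite /state_curves same_loops; congr (_ + _)%N.
apply: (adjunction_n_comp phi) => //; try exact: state_rel_connect_sym.
apply: strict_adjunction => //.
- exact: state_rel_connect_sym.
- exact: can_inj phiK.
- by apply/subsetP => h _; rewrite -(phi'K h) codom_f.
- by move=> h k _; exact: phi_state_rel.
Qed.

Lemma transition_poly_transport (R : comPzRingType) (t : R)
    (W : vertex F -> R * R * R) (W' : vertex F' -> R * R * R) :
  (forall v a, vertex_weight (W' v) a = vertex_weight (W (psi v)) (sigma v a)) ->
  transition_poly W t = transition_poly W' t.
Proof.
move=> EW; rewrite /transition_poly (reindex transport_state); last first.
  exact/onW_bij/(Bijective transport_stateK transport_state_invK).
apply: eq_bigr => s _; rewrite transport_state_curves; congr (_ * _).
rewrite /state_weight (reindex psi); last exact/onW_bij/(Bijective psiK psi'K).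
by apply: eq_bigr => v _; rewrite ffunE psiK EW.
Qed.

End Transport.

(** * One generator at one edge *)

(** The vertex state of the old medial graph that pairs the half-edges at [v_e]
    as the given vertex state does in the new one. *)
Definition generator_state (a : generator) (s : vertex_state) : vertex_state :=
  match a, s with
  | Tau, WhiteSplit => Crossing
  | Tau, Crossing => WhiteSplit
  | Delta, WhiteSplit => BlackSplit
  | Delta, BlackSplit => WhiteSplit
  | _, _ => s
  end.

Lemma generator_stateK a : involutive (generator_state a).
Proof. by case: a => -[]. Qed.

Lemma vertex_weight_generator (R : comPzRingType) a (w : R * R * R) s :
  vertex_weight (generator_weight a w) s = vertex_weight w (generator_state a s).
Proof. by case: a s w => -[] [[]]. Qed.

Section EdgeWeights.
Variables (E : finType) (R : comPzRingType).
Implicit Type W : E -> R * R * R.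

Definition weights_at (act : R * R * R -> R * R * R) (e : E) W : E -> R * R * R :=
  fun e' => if e' == e then act (W e') else W e'.

Lemma transition_poly_ext (G : embedded_graph E) W W' (t : R) : W =1 W' ->
  transition_poly (F := medial G) W t = transition_poly (F := medial G) W' t.
Proof.
move=> EW; apply: eq_bigr => s _; congr (_ * _).
by apply: eq_bigr => e _; rewrite EW.
Qed.

(** The half-edges of both medial graphs are the arrow ends, and the new end [x]
    lies at the old end [tau_end e x] or [delta_end e x].  Under this relabelling
    the edges agree by the definition of the new arcs, and only the colours of
    the pairings at [v_e] are exchanged. *)
Lemma transition_poly_generator (G : embedded_graph E) a e W (t : R) :
  transition_poly (F := medial G) W t =
  transition_poly (F := medial (generator_at a e G))
    (weights_at (generator_weight a) e W) t.
Proof.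
pose sigma (v : E) s := if v == e then generator_state a s else s.
have sigmaK v : involutive (sigma v).
  by move=> s; rewrite /sigma; case: eqP => // _; exact: generator_stateK.
have Wsigma v s : vertex_weight (weights_at (generator_weight a) e W v) s =
    vertex_weight (W v) (sigma v s).
  rewrite /weights_at /sigma; case: eqP => // _; exact: vertex_weight_generator.
case: a @sigma sigmaK Wsigma => sigma sigmaK Wsigma.
- apply: (@transition_poly_transport (medial G) (medial (tau_at e G))
    (tau_end e) (tau_end e) id id sigma sigma) => //.
  + exact: tau_endK.
  + exact: tau_endK.
  + by move=> [[e' i] b] /=; case: ifP.
  + by move=> x /=; rewrite tau_endK.
  (* Compare the three pairings on the four arrow ends at [e]. *)
  move=> s [[e' i] b]; rewrite /sigma /=.
  by case: (eqVneq e' e) => [->|/negPf ne]; case: s i b => -[] [];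
    rewrite /= ?eqxx ?ne.
- apply: (@transition_poly_transport (medial G) (medial (delta_at e G))
    (delta_end e) (delta_end_inv e) id id sigma sigma) => //.
  + exact: delta_endK.
  + exact: delta_end_invK.
  + by move=> [[e' i] b] /=; case: ifP => //; case: b.
  + by move=> x /=; rewrite delta_end_invK.
  move=> s [[e' i] b]; rewrite /sigma /=.
  by case: (eqVneq e' e) => [->|/negPf ne]; case: s i b => -[] [];
    rewrite /= ?eqxx ?ne.
Qed.

(** * Twisted duals *)

(** Words act on graphs and on weights letter by letter in the same order, so each
    letter of the word is an instance of the one-generator case. *)
Lemma transition_poly_word (G : embedded_graph E) u e W (t : R) :
  transition_poly (F := medial G) W t =
  transition_poly (F := medial (word_at u e G))
    (weights_at (word_weight u) e W) t.
Proof.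
elim: u => [|a u IH] /=.
  by apply: transition_poly_ext => e'; rewrite /weights_at if_same.
rewrite IH (transition_poly_generator _ a e); apply: transition_poly_ext => e'.
by rewrite /weights_at; case: eqP.
Qed.

Lemma transition_poly_words (G : embedded_graph E) u r W (t : R) : uniq r ->
  transition_poly (F := medial G) W t =
  transition_poly (F := medial (foldr (fun e K => word_at u e K) G r))
    (fun e => if e \in r then word_weight u (W e) else W e) t.
Proof.
elim: r => [|e r IH] //= /andP[er /IH ->].
rewrite (transition_poly_word _ u e); apply: transition_poly_ext => e'.
by rewrite /weights_at inE; case: eqP => // ->; rewrite (negPf er).
Qed.

(** The weights on the right are those accumulated by the successive dualities,
    which makes sense even when the sets [A i] overlap. *)
Lemma transition_poly_twisted_dual (G : embedded_graph E) xi A W (t : R) :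
  transition_poly (F := medial G) W t =
  transition_poly (F := medial (twisted_dual xi A G))
    (fun e => foldr (fun i w => if e \in A i then word_weight (xi i) w else w)
                (W e) (enum 'I_6)) t.
Proof.
rewrite /twisted_dual; elim: (enum 'I_6) => [|i r IH] //=.
rewrite IH (transition_poly_words _ (xi i) _ _ (enum_uniq (A i))).
by apply: transition_poly_ext => e; rewrite mem_enum.
Qed.

(** An edge lies in at most one of the sets, so at most one step of the iteration
    changes its triple, and [pick] finds the index of that step. *)
Lemma permuted_weights_foldr xi (A : 'I_6 -> {set E}) W e :
    (forall i j, i != j -> [disjoint A i & A j]) ->
  foldr (fun i w => if e \in A i then word_weight (xi i) w else w)
    (W e) (enum 'I_6) = permuted_weights xi A W e.
Proof.
move=> disjA; rewrite /permuted_weights; case: pickP => [i eAi | eA]; last first.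
  by elim: (enum _) => //= i r ->; rewrite eA.
have eA j : (e \in A j) = (j == i).
  apply/idP/eqP => [eAj | -> //]; apply/eqP; apply: contraLR eAj => /disjA.
  by rewrite disjoint_sym => /disjointFr ->.
suff: forall r, uniq r ->
    foldr (fun j w => if e \in A j then word_weight (xi j) w else w) (W e) r =
    if i \in r then word_weight (xi i) (W e) else W e.
  by move=> /(_ _ (enum_uniq _)) ->; rewrite mem_enum.
elim=> [|j r IH] //= /andP[jr /IH ->]; rewrite eA inE eq_sym.
by case: eqP => // ->; rewrite (negPf jr).
Qed.

End EdgeWeights.

Theorem theorem5p7 (E : finType) (G : embedded_graph E) (R : comPzRingType)
    (W : E -> R * R * R) (t : R) (xi : 'I_6 -> word) (A : 'I_6 -> {set E})
    (hxi : enumerates_group xi)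
    (hdisj : forall i j : 'I_6, i != j -> [disjoint A i & A j])
    (hcover : \bigcup_(i : 'I_6) A i = [set: E]) :
  transition_poly (F := medial G) W t
    = transition_poly (F := medial (twisted_dual xi A G))
        (permuted_weights xi A W) t
  /\ Qpoly G W t = Qpoly (twisted_dual xi A G) (permuted_weights xi A W) t.
Proof.
suff EQ : transition_poly (F := medial G) W t =
    transition_poly (F := medial (twisted_dual xi A G))
      (permuted_weights xi A W) t by split.
rewrite (transition_poly_twisted_dual G xi A).
by apply: transition_poly_ext => e; exact: permuted_weights_foldr.
Qed.
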